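(* Let $k$ and $m\geq 2$ be positive integers, let $n_1,\dots,n_m$ be positive integers and $n=n_1+\cdots+n_m$, and assume $k$ divides $n$. Let $\sigma\in\mathrm{SIM}(X)$ have disjoint path and cycle decomposition \[\sigma=\sigma_{11}\cdots\sigma_{1n_1}\,\sigma_{21}\cdots\sigma_{2n_2}\cdots\sigma_{m1}\cdots\sigma_{mn_m}\] consisting only of paths (no cycles), where for some integer $L$ every path $\sigma_{ij}$ has length $\ell(\sigma_{ij})=L-(i-1)$, and $\ell(\sigma_{ij})\geq 2$ for all $i,j$. Then \[ r_k(\sigma)=\sum_{\lambda_1,\dots,\lambda_{m-1}}\frac{n_1!\,n_2!\cdots n_m!}{\left(n/k-\sum_{i=1}^{m-1}\ell(\lambda_i)\right)!\ \prod_{i=1}^{m-1}\prod_{a\in\lambda_i}\mathrm{freq}(a,\lambda_i)!}, \] where the sum is over all tuples of integer partitions $\lambda_1,\dots,\lambda_{m-1}$ such that $\lambda_1\vdash n_1$, $\lambda_2\vdash n_1+n_2-k\ell(\lambda_1)$, and in general $\lambda_j\vdash \sum_{i=1}^{j}n_i-k\sum_{i=1}^{j-1}\ell(\lambda_i)$ for $1\le j\le m-1$, with $\max\lambda_i\leq k$ and $\ell(\lambda_i)\leq (n_{i+1}+\sum\lambda_i)/k$ for all $1\le i\le m-1$. Some of the $\lambda_i$ may be the (empty) partition of zero.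
   Context: For a finite set $X$, $\mathrm{SIM}(X)$ is the symmetric inverse monoid: the set of all partial one-to-one maps from $X$ to itself, under composition. For distinct $a_1,\dots,a_\ell$, the path $[a_1a_2\cdots a_\ell]$ is the partial map sending $a_i\mapsto a_{i+1}$ for $i<\ell$ and undefined at $a_\ell$ (so $[a]$ is the nowhere-defined map on $\{a\}$); the cycle $(a_1\cdots a_\ell)$ sends $a_i\mapsto a_{i+1}$ for $i<\ell$ and $a_\ell\mapsto a_1$. Its length is $\ell$ and $a_1,\dots,a_\ell$ are its digits. Paths/cycles are disjoint if their digit sets are disjoint, and a product of disjoint paths/cycles is the partial map on the union of their digits agreeing with each one on its digits. Every element of $\mathrm{SIM}(X)$ is uniquely a product of disjoint paths and cycles whose digit sets partition $X$ (its disjoint path and cycle decomposition, length-one paths and cycles included). For a positive integer $k$, a $k$th root of $\sigma\in\mathrm{SIM}(X)$ is an $\alpha\in\mathrm{SIM}(X)$ with $\alpha^k=\sigma$, and $r_k(\sigma)$ denotes the number of $k$th roots of $\sigma$. For an integer partition $\lambda: a_1+\cdots+a_t=N$ of $N$ into positive parts we write $\lambda\vdash N$, $\ell(\lambda)=t$ (number of parts), $\max\lambda=\max_i a_i$, $\sum\lambda=N$, and $\mathrm{freq}(a,\lambda)$ is the number of indices $i$ with $a_i=a$; $\prod_{a\in\lambda}$ ranges over the distinct values occurring among the parts. The partition of zero is the empty partition, with length $0$. *)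

(* Defs.v *)
From HB Require Import structures.
From mathcomp Require Import all_boot all_order all_algebra.

Set Implicit Arguments.
Unset Strict Implicit.
Unset Printing Implicit Defensive.

Import Order.TTheory GRing.Theory Num.Theory.
Local Open Scope ring_scope.

Section SymmetricInverseMonoid.
Variable X : finType.

(* A partial map from X to X is an f : {ffun X -> option X}, with domain the
   x such that f x is a Some (through the coercion isSome : option >-> bool). *)
Definition partial_injective (f : {ffun X -> option X}) : bool :=
  dinjectiveb f [pred x | f x].

Record SIM := MkSIM {
  SIM_fun :> {ffun X -> option X};
  SIM_inj : partial_injective SIM_fun
}.

HB.instance Definition _ := [isSub for SIM_fun].
HB.instance Definition _ := [Finite of SIM by <:].

Lemma partial_injectiveP (f : {ffun X -> option X}) :
  reflect (forall x y z, f x = Some z -> f y = Some z -> x = y)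
          (partial_injective f).
Proof.
apply: (iffP (dinjectiveP _ _)) => inj_f.
  by move=> x y z fx fy; apply: inj_f; rewrite ?inE ?fx ?fy.
by move=> x y; rewrite !inE; case fx: (f x) => [z|] // _ _ /esym; apply: inj_f.
Qed.

Lemma SIMP (f g : SIM) : f =1 g -> f = g.
Proof. by move=> eq_fg; apply/val_inj/ffunP. Qed.

Lemma SIM1_subproof : partial_injective [ffun x => Some x].
Proof. by apply/partial_injectiveP => x y z; rewrite !ffunE => -[->] [->]. Qed.

Definition SIM1 : SIM := MkSIM SIM1_subproof.

Lemma SIM_mul_subproof (f g : SIM) :
  partial_injective [ffun x => obind g (f x)].
Proof.
apply/partial_injectiveP => x y z; rewrite !ffunE.
case fx: (f x) => [x'|] //=; case fy: (f y) => [y'|] //= gx gy.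
have eq_xy' := partial_injectiveP _ (SIM_inj g) _ _ _ gx gy.
by rewrite eq_xy' in fx; apply: (partial_injectiveP _ (SIM_inj f)) fx fy.
Qed.

(* Composition from left to right: first f, then g. *)
Definition SIM_mul (f g : SIM) : SIM := MkSIM (SIM_mul_subproof f g).

Lemma SIM_mulA : associative SIM_mul.
Proof.
move=> f g h; apply: SIMP => x; rewrite !ffunE.
by case: (f x) => //= y; rewrite ffunE.
Qed.

Lemma SIM_mul1 : left_id SIM1 SIM_mul.
Proof. by move=> f; apply: SIMP => x; rewrite !ffunE. Qed.

Lemma SIM_mulr1 : right_id SIM1 SIM_mul.
Proof.
move=> f; apply: SIMP => x; rewrite !ffunE.
by case: (f x) => //= y; rewrite ffunE.
Qed.

HB.instance Definition _ :=
  isMonoid.Build SIM SIM_mulA SIM_mul1 SIM_mulr1.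

Definition root_count (k : nat) (s : SIM) : nat :=
  #|[set a : SIM | (a ^+ k)%g == s]|.

Inductive component := Path of seq X | Cycle of seq X.

Definition component_code (c : component) : seq X + seq X :=
  match c with Path s => inl s | Cycle s => inr s end.

Definition component_decode (t : seq X + seq X) : component :=
  match t with inl s => Path s | inr s => Cycle s end.

Lemma component_codeK : cancel component_code component_decode.
Proof. by case. Qed.

HB.instance Definition _ :=
  Equality.copy component (can_type component_codeK).

Definition digits (c : component) : seq X :=
  match c with Path s => s | Cycle s => s end.

(* On its digits a path maps each one to the next and is undefined at the last
   one; [onth] returns None past the end of the sequence. *)
Definition component_fun (c : component) (x : X) : option X :=
  match c with
  | Path s => onth s (index x s).+1
  | Cycle s => if x \in s then Some (next s x) else None
  end.

(* The components in cs are nonempty, and every element of X is exactly once a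
   digit of a component: the digits of each component are distinct and the
   digit sets partition X. *)
Definition decomposition (s : SIM) (cs : seq component) : Prop :=
  [/\ all (fun c => 0 < size (digits c))%N cs,
      perm_eq (flatten [seq digits c | c <- cs]) (enum X) &
      forall c x, c \in cs -> x \in digits c -> s x = component_fun c x].

End SymmetricInverseMonoid.

Arguments Path {X} _.
Arguments Cycle {X} _.

Section IntegerPartitions.

Definition is_intpart (p : seq nat) : bool :=
  sorted geq p && (0%N \notin p).

(* Integer partitions, as nonincreasing sequences of positive parts, of the
   integers not exceeding B; there are finitely many of them. *)
Record intpart_upto (B : nat) := MkIntpart {
  parts :> seq nat;
  partsP : is_intpart parts && (sumn parts <= B)%N
}.

Variable B : nat.

HB.instance Definition _ := [isSub for @parts B].
HB.instance Definition _ := [Countable of intpart_upto B by <:].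

Lemma size_intpart_upto (p : intpart_upto B) : (size p <= B)%N.
Proof.
case: p => p /= /andP[/andP[_ p0] leB]; apply: leq_trans leB.
elim: p p0 => //= a p IHp; rewrite inE negb_or eq_sym -lt0n => /andP[a0 p0].
by rewrite -add1n leq_add ?IHp.
Qed.

Lemma ltn_intpart_upto (p : intpart_upto B) a : a \in parts p -> (a < B.+1)%N.
Proof.
case: p => p /= /andP[_ leB] ap; rewrite ltnS; apply: leq_trans leB.
by rewrite (perm_sumn (perm_to_rem ap)) leq_addr.
Qed.

Definition intpart_code (p : intpart_upto B) : B.-bseq 'I_B.+1 :=
  insub_bseq B [seq inord a | a <- p].

Definition intpart_decode (b : B.-bseq 'I_B.+1) : option (intpart_upto B) :=
  insub [seq val i | i <- b].

Lemma intpart_codeK : pcancel intpart_code intpart_decode.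
Proof.
move=> p; rewrite /intpart_decode /intpart_code insubdK; last first.
  by rewrite unfold_in size_map size_intpart_upto.
rewrite -map_comp (_ : map _ _ = val p) ?valK //.
by apply: map_id_in => a /ltn_intpart_upto ltaB; rewrite /= inordK.
Qed.

HB.instance Definition _ : isFinite (intpart_upto B) :=
  PCanIsFinite intpart_codeK.

End IntegerPartitions.

Definition freq (a : nat) (p : seq nat) : nat := count_mem a p.

Section RootFormula.
Variables (k m : nat) (n : nat -> nat).

Let N := (\sum_(i < m) n i)%N.

(* The indices are shifted by one: n i and lam i stand for n_(i+1) and
   lambda_(i+1). Since lam j is to be a partition of an integer at most
   n_1 + ... + n_(j+1), taking it in intpart_upto N excludes nothing. The sum
   and quotient conditions are stated in int and rat to avoid truncation. *)
Definition admissible (lam : {ffun 'I_m.-1 -> intpart_upto N}) : bool :=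
  [forall j : 'I_m.-1,
    [&& (sumn (lam j))%:Z ==
          \sum_(i < m | (i <= j)%N) (n i)%:Z
          - k%:Z * \sum_(i < m.-1 | (i < j)%N) (size (lam i))%:Z,
        (\max_(a <- lam j) a <= k)%N &
        (size (lam j))%:R <= (n j.+1 + sumn (lam j))%N%:R / k%:R :> rat]].

(* For admissible lam the last quotient condition gives
   \sum_i size (lam i) <= N %/ k, so the subtraction does not truncate. *)
Definition root_term (lam : {ffun 'I_m.-1 -> intpart_upto N}) : rat :=
  (\prod_(i < m) (n i)`!)%N%:R /
  ((N %/ k - \sum_(i < m.-1) size (lam i))`! *
   \prod_(i < m.-1) \prod_(a <- undup (lam i)) (freq a (lam i))`!)%N%:R.

End RootFormula.

(* Main.v *)
Require Import Defs.
From mathcomp Require Import all_boot all_order all_algebra.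

Set Implicit Arguments.
Unset Strict Implicit.
Unset Printing Implicit Defensive.

(** A k-th root of sigma consists of paths only, since a cycle of the root would
    split into cycles of sigma, and the k-th power of a path of length y * k + r
    is the product of r paths of length y.+1 and k - r paths of length y, all
    interleaved. Here every path of sigma is longer than 1, so y > 0 and each
    path of the root interleaves exactly k paths of sigma. Hence a root amounts
    to a set of q = N / k rows of k paths of sigma, the lengths in a row being
    nonincreasing and differing by at most one. Ordering the rows multiplies
    the count by q!, and the resulting q x k tableaux are counted through the
    classes i of their entries, class i consisting of the n_(i+1) paths of
    length L - i: each pattern of classes with the right content is realized by
    n_1! ... n_m! tableaux. A row of a pattern is determined by the class i of
    its first entry and the number a of its entries of that class, the numbers a
    for the rows starting in class i form the partition lambda_(i+1), and the
    patterns with given partitions are counted by a multinomial coefficient. *)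

(** * Injections respecting a coloring *)

Section Content.
Variable T : finType.

Definition content (A : finType) (c : A -> T) : {ffun T -> nat} :=
  [ffun t => #|[set x | c x == t]|].

Lemma sum_content (A : finType) (c : A -> T) (Q : pred T) :
  \sum_(t | Q t) content c t = #|[set x | Q (c x)]|.
Proof.
rewrite -sum1_card (partition_big c Q) => [|x]; last by rewrite inE.
apply: eq_bigr => t Qt; rewrite ffunE -sum1_card; apply: eq_bigl => x.
by rewrite !inE andb_idl // => /eqP->.
Qed.

Lemma card_Tagged_ord (mu : T -> nat) :
  #|{: {t : T & 'I_(mu t)}}| = \sum_t mu t.
Proof.
rewrite card_tagged sumnE big_map big_enum.
by apply: eq_bigr => t _; rewrite card_ord.
Qed.

Lemma content_tag (mu : T -> nat) :
  content (@tag T (fun t => 'I_(mu t))) = [ffun t => mu t].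
Proof.
apply/ffunP => t; rewrite !ffunE -[RHS]card_ord.
rewrite (bij_eq_card (@tag_with_bij T (fun t => 'I_(mu t)) t)).
by rewrite card_sig cardsE.
Qed.

Variables (A B : finType) (d : B -> T).

Lemma card_fresh_of_color (y : T) (s : seq B) : uniq s ->
  #|[set x | d x == y & x \notin s]| = content d y - count_mem y (map d s).
Proof.
move=> us; have -> : [set x | d x == y & x \notin s]
    = [set x | d x == y] :\: [set x in s].
  by apply/setP => x; rewrite !inE andbC.
rewrite cardsD ffunE; congr (_ - _); rewrite count_map -size_filter.
rewrite -(card_uniqP (filter_uniq _ us)); apply: eq_card => x.
by rewrite !inE mem_filter.
Qed.

Definition colored_uniq_tuples (n : nat) (cs : seq T) : {set n.-tuple B} :=
  [set t : n.-tuple B | uniq t & map d t == cs].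

Lemma card_colored_uniq_tuples (n : nat) (cs : n.-tuple T) :
  #|colored_uniq_tuples n cs| = \prod_y content d y ^_ (count_mem y cs).
Proof.
elim: n cs => [|n IHn] cs.
  rewrite tuple0 (@eq_card1 _ [tuple]) => [|t]; last by rewrite [t]tuple0 inE.
  by rewrite big1.
case/tupleP: cs => y cs.
pose tail (t : n.+1.-tuple B) := [tuple of behead t].
rewrite -sum1dep_card (partition_big tail [in colored_uniq_tuples n cs]) => /=;
  last first.
  case/tupleP=> x t; rewrite inE /= eqseq_cons.
  by move=> /andP[/andP[_ ->] /andP[_ ->]].
transitivity (\sum_(t in colored_uniq_tuples n cs)
                (content d y - count_mem y cs)).
  apply: eq_bigr => t; rewrite inE => /andP[ut /eqP dt].
  rewrite -dt -card_fresh_of_color // -sum1dep_card.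
  rewrite (reindex (fun x => [tuple of x :: t])) /=.
    apply: eq_bigl => x; rewrite eqseq_cons dt eqxx ut.
    rewrite (_ : _ == t = true) ?andbT; last exact/eqP/val_inj.
    by rewrite andbC.
  exists (@thead _ _) => [x _|t' /andP[_ /eqP <-]]; first exact: theadE.
  by rewrite -tuple_eta.
rewrite sum_nat_const IHn (bigD1 y) //= [RHS](bigD1 y) //= eqxx ffactnSr.
rewrite mulnAC; congr (_ * _); apply: eq_bigr => z.
by rewrite eq_sym => /negPf->.
Qed.

Definition colored_injections (c : A -> T) : {set {ffun A -> B}} :=
  [set f : {ffun A -> B} | injectiveb f & [forall x, d (f x) == c x]].

Lemma card_colored_injections (c : A -> T) :
  #|colored_injections c| = \prod_y content d y ^_ content c y.
Proof.
have codomE y : count_mem y (codom_tuple c) = content c y.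
  rewrite ffunE cardsE cardE size_filter count_map -enumT.
  by apply: eq_count => x.
under eq_bigr do rewrite -codomE.
have FinfunB : bijective (@Finfun A B).
  by exists fgraph; [apply: FinfunK | apply: fgraphK].
rewrite -card_colored_uniq_tuples -(on_card_preimset (onW_bij _ FinfunB)).
apply: eq_card => t; rewrite !inE -[t in RHS]FinfunK -codom_ffun.
congr (_ && _); rewrite -map_comp; apply/forallP/eqP => [dt|/eq_in_map dt x].
  by apply: eq_map => x; apply/eqP/dt.
by rewrite -[d _]/((d \o Finfun t) x) dt ?mem_enum.
Qed.

Lemma card_colored_injections_eq (c : A -> T) : #|A| = #|B| ->
  #|colored_injections c|
    = if content c == content d then \prod_y (content d y)`! else 0.
Proof.
move=> cardAB; rewrite card_colored_injections.
have [-> | neq_cd] := eqVneq; first by apply: eq_bigr => y _; rewrite ffactnn.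
have [y lt_dc] : exists y, content d y < content c y.
  apply/existsP; apply: contraR neq_cd; rewrite negb_exists => /forallP le_cd.
  have leif_cd y : true -> content c y <= content d y ?= iff
      (content c y == content d y).
    by split=> //; rewrite leqNgt.
  have := (leqif_sum leif_cd).2.
  rewrite !sum_content !cardsT cardAB eqxx => /esym/forallP eq_cd.
  by apply/eqP/ffunP => y; apply/eqP/eq_cd.
by rewrite (bigD1 y) //= ffact_small.
Qed.

Lemma card_injections_coloring (Q : pred {ffun A -> T}) : #|A| = #|B| ->
  #|[set f : {ffun A -> B} | injectiveb f & Q [ffun x => d (f x)]]|
    = #|[set c | Q c & content c == content d]| * \prod_y (content d y)`!.
Proof.
move=> cardAB; rewrite -[LHS]sum1dep_card.
rewrite (partition_big (fun f : {ffun A -> B} => [ffun x => d (f x)]) Q) /=;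
  last by move=> f /andP[].
rewrite -[RHS]sum_nat_cond_const [RHS]big_mkcondr /=; apply: eq_bigr => c Qc.
rewrite -card_colored_injections_eq // -sum1_card; apply: eq_bigl => f.
rewrite inE -andbA; congr (_ && _).
apply/andP/forallP => [[_ /eqP <-] x|dfc]; first by rewrite ffunE.
suff -> : [ffun x => d (f x)] = c by [].
by apply/ffunP => x; rewrite ffunE; apply/eqP.
Qed.

End Content.

Lemma card_content (A T : finType) (mu : {ffun T -> nat}) :
    \sum_y mu y = #|A| ->
  #|[set c : {ffun A -> T} | content c == mu]| * \prod_y (mu y)`! = #|A|`!.
Proof.
move=> sum_mu; pose B := {y : T & 'I_(mu y)}.
have content_B : content (tag : B -> T) = mu by rewrite content_tag ffunK.
have cardB : #|A| = #|{: B}| by rewrite card_Tagged_ord.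
rewrite -[in RHS]ffactnn {1}cardB -card_inj_ffuns -[in LHS]content_B.
rewrite -(card_injections_coloring _ predT) //.
by apply: eq_card => f; rewrite !inE andbT.
Qed.

(** * Roots of a product of paths *)

Section PowersInSIM.
Variable X : finType.
Implicit Types (a : SIM X) (x y z : X).

Lemma SIM_exp0 a x : (a ^+ 0)%g x = Some x.
Proof. by rewrite expg0 ffunE. Qed.

Lemma SIM_expD a u v x :
  (a ^+ (u + v))%g x = obind (a ^+ v)%g ((a ^+ u)%g x).
Proof. by rewrite expgnDr ffunE. Qed.

Lemma SIM_expSr a u x : (a ^+ u.+1)%g x = obind a ((a ^+ u)%g x).
Proof. by rewrite expgSr ffunE. Qed.

Lemma SIM_injective a x y z : a x = Some z -> a y = Some z -> x = y.
Proof. exact: (partial_injectiveP _ (SIM_inj a)). Qed.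

Lemma SIM_exp_defined a u v x :
  u <= v -> (a ^+ v)%g x -> (a ^+ u)%g x.
Proof. by move=> /subnKC <-; rewrite SIM_expD; case: ((a ^+ u)%g x). Qed.

End PowersInSIM.

Lemma decomposition_perm (X : finType) (s : SIM X)
    (cs cs' : seq (component X)) :
  perm_eq cs cs' -> decomposition s cs -> decomposition s cs'.
Proof.
move=> eq_cs [cs_gt0 cs_enum csE]; split=> [||c x].
- by rewrite -(perm_all _ eq_cs).
- by apply: perm_trans cs_enum; apply/perm_flatten/perm_map; rewrite perm_sym.
- by rewrite -(perm_mem eq_cs); apply: csE.
Qed.

(* [d i u] is the u-th point, if any, of the i-th trajectory. *)
Section Trajectories.
Variables (X : finType) (I : choiceType) (d : I -> nat -> option X).
Hypothesis d_onto : forall x, exists i u, d i u = Some x.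
Hypothesis d_inj : forall i u j v x,
  d i u = Some x -> d j v = Some x -> i = j /\ u = v.

Definition follows (a : SIM X) : Prop :=
  forall i u x, d i u = Some x -> a x = d i u.+1.

Lemma follows_unique (a b : SIM X) : follows a -> follows b -> a = b.
Proof.
move=> fa fb; apply: SIMP => x; have [i [u dx]] := d_onto x.
by rewrite (fa _ _ _ dx) (fb _ _ _ dx).
Qed.

Lemma follows_exists : exists a, follows a.
Proof.
have ex_iu x : exists iu : I * nat, d iu.1 iu.2 == Some x.
  by have [i [u dx]] := d_onto x; exists (i, u); apply/eqP.
pose f := [ffun x => d (xchoose (ex_iu x)).1 (xchoose (ex_iu x)).2.+1].
have fE i u x : d i u = Some x -> f x = d i u.+1.
  move=> dx; rewrite ffunE; have /eqP dx' := xchooseP (ex_iu x).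
  by have [-> ->] := d_inj dx' dx.
have f_inj : partial_injective f.
  apply/partial_injectiveP => x y z.
  have [i [u dx]] := d_onto x; have [j [v dy]] := d_onto y.
  rewrite (fE _ _ _ dx) (fE _ _ _ dy) => fx fy.
  have [eq_ij [eq_uv]] := d_inj fx fy.
  by apply: Some_inj; rewrite -dx -dy eq_ij eq_uv.
by exists (MkSIM f_inj).
Qed.

Hypothesis d_prefix : forall i u, d i u.+1 -> d i u.

Lemma follows_exp (a : SIM X) i u v x :
  follows a -> d i u = Some x -> (a ^+ v)%g x = d i (u + v).
Proof.
move=> fa dx; elim: v => [|v IHv]; first by rewrite SIM_exp0 addn0.
rewrite SIM_expSr IHv addnS; have := @d_prefix i (u + v).
case dy: (d i (u + v)) => [y|] /=; first by move=> _; apply: fa.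
by case: (d i (u + v).+1) => // z /(_ isT).
Qed.

End Trajectories.

Section PathDecomposition.
Variables (X P : finType) (S : P -> seq X) (sigma : SIM X).
Hypothesis sigma_dec : decomposition sigma [seq Path (S p) | p <- enum P].

Definition digit (p : P) (y : nat) : option X := onth (S p) y.

Lemma path_in_decomposition p : Path (S p) \in [seq Path (S p) | p <- enum P].
Proof. by apply/mapP; exists p; rewrite ?mem_enum. Qed.

Lemma path_nonempty p : 0 < size (S p).
Proof. by have [/allP/(_ _ (path_in_decomposition p))] := sigma_dec. Qed.

Lemma digits_enum : perm_eq (flatten [seq S p | p <- enum P]) (enum X).
Proof. by have [_ + _] := sigma_dec; rewrite -map_comp. Qed.

Lemma sum_count_digits x : \sum_p count_mem x (S p) = 1.
Proof.
rewrite -big_enum -(big_map (fun p => count_mem x (S p)) xpredT id).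
rewrite -sumnE (map_comp (count_mem x) S) -count_flatten.
by rewrite (seq.permP digits_enum) count_uniq_mem ?enum_uniq ?mem_enum.
Qed.

Lemma path_uniq p : uniq (S p).
Proof.
apply: count_mem_uniq => x; have := sum_count_digits x.
rewrite (bigD1 p) //= -has_pred1 has_count.
by case: (count_mem x (S p)) => [|[|c]].
Qed.

Lemma path_of_digit_unique p p' x : x \in S p -> x \in S p' -> p = p'.
Proof.
move=> xp xp'; apply/eqP; apply: contraT => npp'; have := sum_count_digits x.
rewrite (bigD1 p) // (bigD1 p') 1?eq_sym //=.
move: xp xp'; rewrite -!has_pred1 !has_count.
by case: count => // c _; case: count => // c' _; rewrite !addSn addnS.
Qed.

Lemma digit_onto x : exists p y, digit p y = Some x.
Proof.
have : x \in flatten [seq S p | p <- enum P].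
  by rewrite (perm_mem digits_enum) mem_enum.
by case/flatten_mapP=> p _ /onthP[y dx]; exists p, y.
Qed.

Lemma digit_inj p y p' y' x :
  digit p y = Some x -> digit p' y' = Some x -> p = p' /\ y = y'.
Proof.
move=> dx dx'.
have eq_p : p = p'.
  by apply: (@path_of_digit_unique _ _ x); apply/onthP; [exists y | exists y'].
split=> //; rewrite -eq_p in dx'; apply: (onth_inj (S p) _ _ (path_uniq p)).
  by rewrite gtn_min -!onthTE -!/(digit p _) dx orbT.
exact: etrans dx (esym dx').
Qed.

Lemma digit_prefix p y : digit p y.+1 -> digit p y.
Proof. by rewrite /digit !onthTE; apply: ltnW. Qed.

Lemma path_follows : follows digit sigma.
Proof.
move=> p y x dx; have xp : x \in S p by apply/onthP; exists y.
have [_ _ /(_ _ x (path_in_decomposition p) xp)-> /=] := sigma_dec.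
have dx' : digit p (index x (S p)) = Some x.
  by rewrite /digit onthE (nth_map x) ?nth_index ?index_mem.
by have [_ ->] := digit_inj dx' dx.
Qed.

Lemma start_proof p : {x | digit p 0 = Some x}.
Proof.
by rewrite /digit; case: (S p) (path_nonempty p) => //= x s _; exists x.
Qed.

Definition start p : X := sval (start_proof p).

Lemma digit0 p : digit p 0 = Some (start p).
Proof. exact: svalP (start_proof p). Qed.

Lemma start_inj : injective start.
Proof.
move=> p p' eq_start; have := digit0 p'; rewrite -eq_start => dx.
by have [] := digit_inj (digit0 p) dx.
Qed.

Lemma start_notin_codom p y : sigma y <> Some (start p).
Proof.
have [p' [j dy]] := digit_onto y; rewrite (path_follows dy) => dx.
by have [] := digit_inj dx (digit0 p).
Qed.

Lemma notin_codom_start x :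
  (forall y, sigma y <> Some x) -> exists p, x = start p.
Proof.
move=> xNsigma; have [p [[|j] dx]] := digit_onto x.
  by exists p; apply: Some_inj; rewrite -digit0.
have : digit p j by apply: digit_prefix; rewrite dx.
case dy: (digit p j) => [y|] // _.
by case: (xNsigma y); rewrite (path_follows dy).
Qed.

Lemma sigma_exp_start p y : (sigma ^+ y)%g (start p) = digit p y.
Proof. exact: (follows_exp digit_prefix y path_follows (digit0 p)). Qed.

Section Tableaux.
Variables (k' q : nat).
Local Notation k := k'.+1.
Local Notation tableau := {ffun 'I_q * 'I_k -> P}.
Hypothesis cardP : #|P| = q * k.
Hypothesis path_nontrivial : forall p, 1 < size (S p).
Implicit Types (w : tableau) (b : 'I_q) (a : SIM X).

(* The u-th digit of the path obtained by interleaving the paths in row b: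
   the first digits of these paths in turn, then the second digits, etc. *)
Definition interleave w b (u : nat) : option X :=
  digit (w (b, inord (u %% k))) (u %/ k).

Lemma interleaveE w b y (i : 'I_k) :
  interleave w b (y * k + i) = digit (w (b, i)) y.
Proof.
rewrite /interleave modnMDl divnMDl // modn_small // divn_small // addn0.
by rewrite inord_val.
Qed.

Lemma interleave_start w b (i : 'I_k) :
  interleave w b i = Some (start (w (b, i))).
Proof. by rewrite -[nat_of_ord i]/(0 * k + i) interleaveE digit0. Qed.

Lemma interleave_onto w : injective w ->
  forall x, exists b u, interleave w b u = Some x.
Proof.
move=> w_inj x; have [p [y dx]] := digit_onto x.
have /codomP[[b i] wp] : p \in codom w.
  by apply: inj_card_onto => //; rewrite cardP card_prod !card_ord.
by exists b, (y * k + i); rewrite interleaveE -wp.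
Qed.

Lemma interleave_inj w : injective w -> forall b u b' u' x,
  interleave w b u = Some x -> interleave w b' u' = Some x -> b = b' /\ u = u'.
Proof.
move=> w_inj b u b' u' x dx dx'.
have [/w_inj[eq_b /(congr1 val) eq_mod] eq_div] := digit_inj dx dx'.
rewrite /= !inordK ?ltn_pmod // in eq_mod.
by split; rewrite // (divn_eq u k) (divn_eq u' k) eq_mod eq_div.
Qed.

Definition interleavable w : bool :=
  [forall b, forall i : 'I_k, forall j : 'I_k, (i <= j) ==>
    (size (S (w (b, j))) <= size (S (w (b, i))) <= (size (S (w (b, j)))).+1)].

Lemma interleavable_prefix w b u :
  interleavable w -> interleave w b u.+1 -> interleave w b u.
Proof.
move=> /forallP/(_ b)/forallP sizes; rewrite /interleave /digit modnS divnS //.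
have u_k : u %% k < k by rewrite ltn_pmod.
case: ifP => dvd_k; rewrite !onthTE.
  have /forallP/(_ (inord (u %% k))) := sizes (inord 0).
  rewrite !inordK //= => /andP[_ le_size].
  by rewrite add1n => /leq_trans/(_ le_size).
have uS_k : (u %% k).+1 < k.
  rewrite ltn_neqAle u_k andbT; apply: contraFN dvd_k => /eqP mod_k.
  by rewrite {1}(divn_eq u k) -addnS mod_k dvdn_add ?dvdn_mull.
have /forallP/(_ (inord (u %% k).+1)) := sizes (inord (u %% k)).
by rewrite !inordK // leqnSn => /andP[le_size _] /leq_trans; apply.
Qed.

Lemma prefix_interleavable w :
  (forall b u, interleave w b u.+1 -> interleave w b u) -> interleavable w.
Proof.
move=> w_prefix.
have down b u v : u <= v -> interleave w b v -> interleave w b u.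
  move/subnKC <-; elim: (v - u) => [|n IHn]; first by rewrite addn0.
  by rewrite addnS => /w_prefix.
apply/forallP => b; apply/forallP => i; apply/forallP => j; apply/implyP => ij.
apply/andP; split.
  case size_j: (size (S (w (b, j)))) => [|y] //.
  rewrite -onthTE -/(digit _ y) -interleaveE; apply: (down _ _ (y * k + j)).
    by rewrite leq_add2l.
  by rewrite interleaveE /digit onthTE size_j.
case size_i: (size (S (w (b, i)))) => [|[|y]] //.
rewrite ltnS -onthTE -/(digit _ y) -interleaveE.
apply: (down _ _ (y.+1 * k + i)); last first.
  by rewrite interleaveE /digit onthTE size_i.
by rewrite mulSn -addnA addnCA leq_add2l ltnW // ltn_addr.
Qed.

Definition represents a w : bool :=
  [forall b, forall i : 'I_k,
    (a ^+ i)%g (start (w (b, ord0))) == Some (start (w (b, i)))].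

Lemma root_expD a y i x : (a ^+ k)%g = sigma ->
  (a ^+ (y * k + i))%g x = obind (sigma ^+ y)%g ((a ^+ i)%g x).
Proof. by move=> ak; rewrite addnC SIM_expD mulnC expgnA ak. Qed.

Lemma represents_interleave a w b u : (a ^+ k)%g = sigma -> represents a w ->
  (a ^+ u)%g (start (w (b, ord0))) = interleave w b u.
Proof.
move=> ak /forallP/(_ b)/forallP/(_ (inord (u %% k)))/eqP.
rewrite inordK ?ltn_pmod // => a_start.
by rewrite {1}(divn_eq u k) root_expD // a_start /= sigma_exp_start.
Qed.

Lemma represents_interleavable a w :
  (a ^+ k)%g = sigma -> represents a w -> interleavable w.
Proof.
move=> ak aw; apply: prefix_interleavable => b u.
by rewrite -!(represents_interleave _ _ ak aw); apply: SIM_exp_defined.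
Qed.

Lemma represents_iff_follows a w : injective w -> interleavable w ->
  (a ^+ k)%g = sigma /\ represents a w <-> follows (interleave w) a.
Proof.
move=> w_inj w_int; split=> [[ak aw] b u x|aw].
  by rewrite -!(represents_interleave _ _ ak aw) SIM_expSr => ->.
have a_exp b u v x : interleave w b u = Some x ->
    (a ^+ v)%g x = interleave w b (u + v).
  by apply: follows_exp => // {}b {}u; apply: interleavable_prefix.
split; last first.
  apply/forallP => b; apply/forallP => i.
  by rewrite (a_exp _ _ _ _ (interleave_start w b ord0)) interleave_start.
apply: SIMP => x; have [b [u dx]] := interleave_onto w_inj x.
rewrite (a_exp _ _ _ _ dx) (path_follows dx) /interleave.
by rewrite modnDr divnDr ?dvdnn // divnn addn1.
Qed.

Lemma card_represented w : injective w ->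
  #|[set a : SIM X | ((a ^+ k)%g == sigma) && represents a w]|
    = interleavable w.
Proof.
move=> w_inj; have [w_int | w_nint] := boolP (interleavable w); last first.
  apply/eqP; rewrite cards_eq0; apply/eqP/setP => a; rewrite !inE.
  apply: contraNF w_nint => /andP[/eqP ak aw].
  exact: represents_interleavable ak aw.
have [a fa] := follows_exists (interleave_onto w_inj) (interleave_inj w_inj).
apply/eqP/cards1P; exists a; apply/setP => a'; rewrite !inE.
have aw := represents_iff_follows _ w_inj w_int.
apply/andP/eqP => [[/eqP a'k a'w] | ->].
  by apply: (follows_unique (interleave_onto w_inj)) fa; apply/aw.
by have [/eqP] := (aw a).2 fa.
Qed.

Section FixedRoot.
Variable a : SIM X.
Hypothesis ak : (a ^+ k)%g = sigma.

Definition heads : {set P} := [set p | [forall y, a y != Some (start p)]].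

Lemma exp_into_head p i x :
  p \in heads -> (a ^+ i)%g x = Some (start p) -> i = 0.
Proof.
rewrite inE => /forallP pN; case: i => // i; rewrite SIM_expSr.
by case: ((a ^+ i)%g x) => //= y ay; have := pN y; rewrite ay eqxx.
Qed.

Lemma exp_head_start p i : p \in heads -> i < k ->
  exists p', (a ^+ i)%g (start p) = Some (start p').
Proof.
move=> p_head ik; have : (a ^+ i)%g (start p).
  apply: (SIM_exp_defined (ltnW ik)); rewrite ak -[sigma]expg1 sigma_exp_start.
  by rewrite /digit onthTE.
case ax: ((a ^+ i)%g (start p)) => [x|] // _.
suff [p' ->] : exists p', x = start p' by exists p'.
apply: notin_codom_start => y; rewrite -ak -(subnK (ltnW ik)) SIM_expD => ay.
case az: ((a ^+ (k - i))%g y) ay => [z|] //= /SIM_injective/(_ ax) eq_z.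
rewrite eq_z in az; have := exp_into_head p_head az.
by apply/eqP; rewrite subn_eq0 -ltnNge.
Qed.

Definition path_after p i : P :=
  odflt p [pick p' | (a ^+ i)%g (start p) == Some (start p')].

Lemma path_afterE p i : p \in heads -> i < k ->
  (a ^+ i)%g (start p) = Some (start (path_after p i)).
Proof.
move=> p_head ik; rewrite /path_after; case: pickP => [p' /eqP //|no_p'].
by have [p' /eqP] := exp_head_start p_head ik; rewrite no_p'.
Qed.

Lemma path_after0 p : p \in heads -> path_after p 0 = p.
Proof.
move=> p_head; have := path_afterE p_head (ltn0Sn _).
by rewrite SIM_exp0 => -[/start_inj].
Qed.

Lemma path_after_inj p i p' i' : p \in heads -> p' \in heads ->
  i < k -> i' < k -> path_after p i = path_after p' i' -> p = p' /\ i = i'.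
Proof.
wlog le_ii' : p i p' i' / i <= i' => [wlog_le hp hp' ik i'k eq_pp'|].
  have [le|/ltnW le] := leqP i i'; first exact: wlog_le.
  by have [-> ->] := wlog_le _ _ _ _ le hp' hp i'k ik (esym eq_pp').
move=> hp hp' ik i'k eq_pp'; have := path_afterE hp' i'k.
rewrite -eq_pp' -(subnK le_ii') SIM_expD.
case az: ((a ^+ (i' - i))%g _) => [z|] //= az_start.
have eq_z := SIM_injective az_start (path_afterE hp ik).
rewrite eq_z in az; have sub0 := exp_into_head hp az.
by move: az; rewrite sub0 SIM_exp0 => -[/start_inj->].
Qed.

(* Go back from [start p] along a as far as possible. Fewer than k steps are
   possible since [start p] is not in the image of a ^+ k. *)
Lemma path_after_onto p :
  exists2 p', p' \in heads & exists2 i, i < k & p = path_after p' i.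
Proof.
pose back i := [exists y, (a ^+ i)%g y == Some (start p)].
have back0 : exists i, back i.
  by exists 0; apply/existsP; exists (start p); rewrite SIM_exp0.
have back_lt i : back i -> i <= k'.
  case/existsP => y /eqP ay; rewrite -ltnS ltnNge; apply/negP => ki.
  move: ay; rewrite -(subnK ki) SIM_expD; case: ((a ^+ (i - k))%g y) => //= z.
  by rewrite ak => /start_notin_codom.
have [i /existsP[y /eqP ay] max_i] := ex_maxnP back0 back_lt.
have ik : i < k by rewrite ltnS back_lt //; apply/existsP; exists y; rewrite ay.
have yN z : a z <> Some y.
  move=> az; suff /max_i : back i.+1 by rewrite ltnn.
  by apply/existsP; exists z; rewrite -add1n SIM_expD expg1 az /= ay.
have [p' y_start] : exists p', y = start p'.
  apply: notin_codom_start => z; rewrite -ak SIM_expSr.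
  by case: ((a ^+ k')%g z) => //= z'; apply: yN.
have p'_head : p' \in heads.
  by rewrite inE; apply/forallP => z; apply/eqP; rewrite -y_start; apply: yN.
exists p' => //; exists i => //; apply/start_inj/Some_inj.
by rewrite -path_afterE // -y_start ay.
Qed.

Lemma card_heads : #|heads| = q.
Proof.
apply/eqP; rewrite -(@eqn_pmul2r k) // -cardP.
rewrite -{1}(card_ord k) -(cardsT 'I_k) -cardsX -(cardsT P).
pose after (pi : P * 'I_k) := path_after pi.1 pi.2.
rewrite -(@card_in_imset _ _ after) => [|[p i] [p' i']]; last first.
  move=> /setXP[/= hp _] /setXP[/= hp' _] eq_after.
  by have [-> /val_inj->] :=
    path_after_inj hp hp' (ltn_ord i) (ltn_ord i') eq_after.
apply/eqP/eq_card => p; rewrite inE.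
have [p' hp' [i ik ->]] := path_after_onto p.
by apply/imsetP; exists (p', Ordinal ik); rewrite // in_setX hp' inE.
Qed.

Lemma represents_heads w b :
  injective w -> represents a w -> w (b, ord0) \in heads.
Proof.
move=> w_inj aw; rewrite inE; apply/forallP => y; apply/eqP => ay.
have [b' [u dy]] := interleave_onto w_inj y.
have dS : interleave w b' u.+1 = Some (start (w (b, ord0))).
  rewrite -(represents_interleave _ _ ak aw) SIM_expSr.
  by rewrite (represents_interleave _ _ ak aw) dy.
by have [] := interleave_inj w_inj dS (interleave_start w b ord0).
Qed.

Definition tableau_of_heads (h : {ffun 'I_q -> P}) : tableau :=
  [ffun bi : 'I_q * 'I_k => path_after (h bi.1) bi.2].

Definition head_columns : {set {ffun 'I_q -> P}} :=
  [set h : {ffun 'I_q -> P} in ffun_on (mem heads) | injectiveb h].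

Lemma tableau_of_heads_inj : {in head_columns &, injective tableau_of_heads}.
Proof.
move=> h h'; rewrite !inE => /andP[/ffun_onP heads_h _].
move=> /andP[/ffun_onP heads_h' _] /ffunP eq_w.
apply/ffunP => b; have := eq_w (b, ord0).
by rewrite !ffunE /= !path_after0.
Qed.

Lemma representing_tableauxE :
  [set w : tableau | injectiveb w & represents a w]
    = tableau_of_heads @: head_columns.
Proof.
apply/setP => w; rewrite inE; apply/andP/imsetP.
  move=> [/injectiveP w_inj aw]; exists [ffun b => w (b, ord0)].
    rewrite !inE; apply/andP; split.
      by apply/ffun_onP => b; rewrite ffunE represents_heads.
    by apply/injectiveP => b b'; rewrite !ffunE => /w_inj[].
  apply/ffunP => -[b i]; rewrite !ffunE /=; apply/start_inj/Some_inj.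
  rewrite -path_afterE ?represents_heads //.
  by move/forallP/(_ b)/forallP/(_ i)/eqP: aw.
move=> [h]; rewrite !inE => /andP[/ffun_onP heads_h /injectiveP h_inj] ->.
split.
  apply/injectiveP => -[b i] [b' i']; rewrite !ffunE /=.
  by case/path_after_inj; rewrite ?heads_h // => /h_inj-> /val_inj->.
apply/forallP => b; apply/forallP => i; rewrite !ffunE /=.
by rewrite path_after0 ?path_afterE.
Qed.

Lemma card_representing :
  #|[set w : tableau | injectiveb w & represents a w]| = q`!.
Proof.
rewrite representing_tableauxE card_in_imset; last exact: tableau_of_heads_inj.
by rewrite card_inj_ffuns_on card_heads card_ord ffactnn.
Qed.

End FixedRoot.

Lemma root_count_interleavable :
  root_count k sigma * q`!
    = #|[set w : tableau | injectiveb w & interleavable w]|.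
Proof.
pose R a w := [&& (a ^+ k)%g == sigma, injectiveb w & represents a w].
transitivity (\sum_a \sum_(w | R a w) 1).
  rewrite -sum_nat_cond_const big_mkcond; apply: eq_bigr => a _.
  case: ifP => [/eqP ak|ak]; last by rewrite big_pred0 // => w; rewrite /R ak.
  rewrite -(card_representing ak) -sum1dep_card.
  by apply: eq_bigl => w; rewrite /R ak eqxx.
rewrite (exchange_big_dep xpredT) //= -sum1dep_card [RHS]big_mkcond /=.
apply: eq_bigr => w _.
have [w_inj | w_ninj] := boolP (injectiveb w); last first.
  by rewrite big_pred0 // => a; rewrite /R (negPf w_ninj) andbF.
transitivity (nat_of_bool (interleavable w)); last by case: interleavable.
rewrite -(card_represented (injectiveP _ w_inj)) -sum1dep_card.
by apply: eq_bigl => a; rewrite /R w_inj.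
Qed.

End Tableaux.
End PathDecomposition.

(** * Types of rows and their partitions *)

Lemma is_intpart_parts (B : nat) (p : intpart_upto B) : is_intpart p.
Proof. by case/andP: (partsP p). Qed.

Lemma zero_notin_parts (B : nat) (p : intpart_upto B) : 0 \notin parts p.
Proof. by case/andP: (is_intpart_parts p). Qed.

Lemma freq_bounded (k a : nat) (p : seq nat) :
  all (leq^~ k) p -> k < a -> freq a p = 0.
Proof.
move=> /allP p_le_k k_lt_a; apply/count_memPn; apply: contraL k_lt_a => /p_le_k.
by rewrite -leqNgt.
Qed.

Lemma eq_bounded_intpart (k : nat) (p p' : seq nat) :
    is_intpart p -> is_intpart p' ->
    all (leq^~ k) p -> all (leq^~ k) p' ->
  (forall a : 'I_k, freq a.+1 p = freq a.+1 p') -> p = p'.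
Proof.
move=> /andP[sorted_p p0] /andP[sorted_p' p'0] p_le_k p'_le_k eq_freq.
have geq_trans : transitive geq by move=> x y z yx zx; apply: leq_trans zx yx.
have geq_anti : antisymmetric geq.
  by move=> x y; rewrite andbC -eqn_leq => /eqP.
apply: (sorted_eq geq_trans geq_anti sorted_p sorted_p').
apply/allP => -[|a] _ /=; first by rewrite (count_memPn p0) (count_memPn p'0).
apply/eqP; have [ak | ka] := ltnP a k; first exact: eq_freq (Ordinal ak).
exact: etrans (freq_bounded p_le_k _) (esym (freq_bounded p'_le_k _)).
Qed.

Section BoundedParts.
Variables (k : nat) (p : seq nat).
Hypotheses (p0 : 0 \notin p) (p_le_k : all (leq^~ k) p).

Lemma big_freq (R : Type) (idx : R) (op : Monoid.com_law idx) (F : nat -> R) :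
  F 0 = idx ->
  \big[op/idx]_(a <- undup p) F (freq a p)
    = \big[op/idx]_(a < k) F (freq a.+1 p).
Proof.
move=> F0; rewrite -(big_mkord xpredT (fun a => F (freq a.+1 p))).
rewrite -(big_add1 _ _ 0 k.+1 xpredT (fun a => F (freq a p))).
rewrite [RHS](bigID (mem p)) /= [X in op _ X]big1 => [|a /count_memPn pNa].
  rewrite Monoid.mulm1 -[RHS]big_filter; apply/perm_big/uniq_perm => [||a].
  - exact: undup_uniq.
  - by rewrite filter_uniq // iota_uniq.
  rewrite mem_undup mem_filter mem_index_iota.
  have [ap|//] := boolP (a \in p); rewrite ltnS (allP p_le_k) // andbT.
  by rewrite lt0n; case: eqP ap p0 => // -> ->.
by rewrite /freq pNa.
Qed.

Lemma size_freq : size p = \sum_(a < k) freq a.+1 p.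
Proof.
rewrite -(big_freq _ (F := id)) // -(perm_size (perm_count_undup p)).
rewrite size_flatten /shape -map_comp sumnE big_map.
by apply: eq_bigr => a _; rewrite /= size_nseq.
Qed.

End BoundedParts.

Lemma big_ord_ltS (R : Type) (idx : R) (op : Monoid.com_law idx) (m : nat)
    (F : 'I_m -> R) (j : 'I_m) :
  \big[op/idx]_(i < m | i < j.+1) F i
    = op (\big[op/idx]_(i < m | i < j) F i) (F j).
Proof.
rewrite (bigD1 j) //= Monoid.mulmC; congr (op _ _); apply: eq_bigl => i.
by rewrite ltnS -val_eqE andbC -ltn_neqAle.
Qed.

Lemma eq_from_prefix_sums (m : nat) (f g : {ffun 'I_m -> nat}) :
    (forall j, j <= m -> \sum_(i < m | i < j) f i = \sum_(i < m | i < j) g i) ->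
  f = g.
Proof.
move=> eq_sums; apply/ffunP => j; have := eq_sums j.+1 (ltn_ord j).
by rewrite !big_ord_ltS eq_sums ?(ltnW (ltn_ord j)) // => /addnI.
Qed.

Section RowTypes.
Variables (M k' : nat).
Local Notation k := k'.+1.

(* [Some (i, a)] is the type of a row consisting of a.+1 entries of class i
   followed by entries of class i.+1, and [None] that of a row consisting only
   of entries of the last class M. *)
Definition row_type := option ('I_M * 'I_k).

Definition row_class (y : row_type) (j : 'I_k) : 'I_M.+1 :=
  if y is Some (i, a) then
    if j <= a then widen_ord (leqnSn M) i else lift ord0 i
  else ord_max.

Definition single_step (c : 'I_k -> 'I_M.+1) : bool :=
  [forall i : 'I_k, forall j : 'I_k, (i <= j) ==> (c i <= c j <= (c i).+1)].

Lemma row_class_leq y (j : 'I_k) (c : 'I_M) :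
  (row_class y j <= c) =
    if y is Some (i, a) then (i < c) || (i == c) && (j <= a) else false.
Proof.
case: y => [[i a]|] /=; last by rewrite leqNgt ltn_ord.
by case: (j <= a); rewrite ?lift0 ?andbT ?andbF ?orbF // leq_eqVlt orbC.
Qed.

Lemma row_class_inj y y' : row_class y =1 row_class y' -> y = y'.
Proof.
move=> eq_yy'; have eq_leq j c : (row_class y j <= c) = (row_class y' j <= c).
  by rewrite eq_yy'.
case: y y' eq_yy' eq_leq => [[i a]|] [[i' a']|] // eq_yy' eq_leq.
- have eq_i : i = i' by apply/val_inj; have /(congr1 val) := eq_yy' ord0.
  subst i'; congr (Some (_, _)); apply/val_inj/eqP; rewrite eqn_leq.
  have := eq_leq a i; have := eq_leq a' i.
  by rewrite !row_class_leq ltnn eqxx !leqnn /= => -> <-.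
- by have := eq_leq ord0 i; rewrite !row_class_leq eqxx orbT.
by have := eq_leq ord0 i'; rewrite !row_class_leq eqxx orbT.
Qed.

Lemma row_class_single_step y : single_step (row_class y).
Proof.
apply/forallP => i; apply/forallP => j; apply/implyP => ij.
case: y => [[c a]|] /=; last by rewrite leqnn leqnSn.
case: (leqP j a) => [/(leq_trans ij)->|_] /=; first by rewrite leqnn leqnSn.
by case: ifP => _; rewrite /= ?leqnn ?leqnSn.
Qed.

Lemma single_step_row_class (c : 'I_k -> 'I_M.+1) :
  single_step c -> exists y, c =1 row_class y.
Proof.
move=> c_step; have between (i j : 'I_k) : i <= j -> c i <= c j <= (c i).+1.
  by move/forallP/(_ i)/forallP/(_ j)/implyP: c_step; apply.
have [c0_lt|c0_max] := ltnP (c ord0) M; last first.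
  exists None => j; apply/val_inj/eqP; rewrite eqn_leq -ltnS ltn_ord /=.
  by have /andP[+ _] := between ord0 j (leq0n j); apply: leq_trans.
have [a /eqP ca max_a] :=
  @arg_maxnP _ ord0 (fun j => c j == c ord0) val (eqxx _).
exists (Some (Ordinal c0_lt, a)) => j; apply/val_inj => /=.
have /andP[le0 leS] := between ord0 j (leq0n j).
case: leqP => [ja|aj] /=.
  apply/eqP; rewrite eqn_leq le0 andbT -ca.
  by have /andP[] := between _ _ ja.
apply/eqP; rewrite eqn_leq leS ltn_neqAle le0 andbT.
apply: contraTneq aj => eq_c; rewrite -leqNgt; apply: max_a.
exact/eqP/val_inj/esym.
Qed.

Section Patterns.
Variable q : nat.
Implicit Types (t : {ffun 'I_q -> row_type}).

Definition pattern t : {ffun 'I_q * 'I_k -> 'I_M.+1} :=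
  [ffun x => row_class (t x.1) x.2].

Definition single_step_rows (c : {ffun 'I_q * 'I_k -> 'I_M.+1}) : bool :=
  [forall b, single_step (fun j => c (b, j))].

Lemma pattern_inj : injective pattern.
Proof.
move=> t t' /ffunP eq_tt'; apply/ffunP => b; apply: row_class_inj => j.
by have := eq_tt' (b, j); rewrite !ffunE.
Qed.

Lemma imset_pattern : pattern @: setT = [set c | single_step_rows c].
Proof.
apply/setP => c; rewrite inE; apply/imsetP/forallP => [[t _ ->] b | c_step].
  suff -> : single_step (fun j => pattern t (b, j)) =
            single_step (row_class (t b)) by apply: row_class_single_step.
  by apply: eq_forallb => i; apply: eq_forallb => j; rewrite !ffunE.
have [t tE] := fin_all_exists (fun b => single_step_row_class (c_step b)).
exists [ffun b => t b]; rewrite ?inE //; apply/ffunP => -[b j].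
by rewrite !ffunE -tE.
Qed.

Lemma card_single_step_rows (Q : pred {ffun 'I_q * 'I_k -> 'I_M.+1}) :
  #|[set c | single_step_rows c & Q c]| = #|[set t | Q (pattern t)]|.
Proof.
rewrite -(card_imset _ pattern_inj); apply: eq_card => c.
apply/idP/imsetP => [|[t]]; rewrite !inE.
  case/andP; have := in_set (@single_step_rows) c; rewrite -imset_pattern.
  by move=> <- /imsetP[t _ ->] Qt; exists t; rewrite ?inE.
by move=> Qt ->; rewrite Qt andbT -in_set -imset_pattern imset_f.
Qed.

End Patterns.

Definition lead_class (y : row_type) : option 'I_M := omap fst y.

Definition lead_length (y : row_type) : nat :=
  if y is Some (_, a) then a.+1 else 0.

Lemma card_row_class_leq (y : row_type) (c : 'I_M) :
  #|[set j | row_class y j <= c]| =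
    (if lead_class y == Some c then lead_length y else 0)
    + k * (\sum_(i < M | i < c) (lead_class y == Some i)).
Proof.
have sum_lead i : \sum_(l < M | l < c) (Some i == Some l) = (i < c).
  rewrite big_mkcond (bigD1 i) //= eqxx big1 ?addn0 => [|l]; first by case: ifP.
  by rewrite eq_sym (inj_eq Some_inj) => /negPf->; case: ifP.
under eq_finset do rewrite row_class_leq.
case: y => [[i a]|] /=; last by rewrite big1 // muln0 -[RHS](cards0 'I_k).
rewrite sum_lead (inj_eq Some_inj) -val_eqE /=.
case: ltngtP => _ /=.
- by rewrite muln1 -[RHS]card_ord -cardsT.
- by rewrite muln0 -[RHS](cards0 'I_k).
rewrite muln0 addn0 -[RHS](card_ord a.+1) -[RHS]sum1_card.
by rewrite (big_ord_widen k (fun=> 1)) // -sum1dep_card.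
Qed.

Lemma big_row_type (R : Type) (idx : R) (op : Monoid.com_law idx)
    (F : row_type -> R) :
  \big[op/idx]_y F y =
  op (F None) (\big[op/idx]_(i < M) \big[op/idx]_(a < k) F (Some (i, a))).
Proof.
rewrite (bigD1 None) //=; congr (op _ _).
rewrite pair_big /= (reindex_omap Some id) /=; last by case.
by apply: eq_big => [[i a]|[i a] _] //=; rewrite eqxx.
Qed.

Section RowPartitions.
Variable q : nat.
Implicit Types (t : {ffun 'I_q -> row_type}) (i : 'I_M).

Definition row_parts t i : seq nat :=
  sort geq
    [seq lead_length (t b) | b <- enum 'I_q & lead_class (t b) == Some i].

Lemma row_parts_bounds t i a : a \in row_parts t i -> 0 < a <= k.
Proof.
rewrite mem_sort => /mapP[b]; rewrite mem_filter => /andP[+ _] ->.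
by case: (t b) => [[c j]|] //= _.
Qed.

Lemma zero_notin_row_parts t i : 0 \notin row_parts t i.
Proof. by apply/negP => /row_parts_bounds. Qed.

Lemma row_parts_leq t i : all (leq^~ k) (row_parts t i).
Proof. by apply/allP => a /row_parts_bounds/andP[]. Qed.

Lemma size_row_parts t i :
  size (row_parts t i) = \sum_b (lead_class (t b) == Some i).
Proof.
rewrite size_sort size_map size_filter -sum1_count -big_mkcond.
by rewrite [LHS]big_enum_cond.
Qed.

Lemma sumn_row_parts t i :
  sumn (row_parts t i)
    = \sum_(b | lead_class (t b) == Some i) lead_length (t b).
Proof.
rewrite (perm_sumn (permEl (perm_sort _ _))).
by rewrite sumnE big_map big_filter big_enum_cond.
Qed.

Lemma is_intpart_row_parts t i : is_intpart (row_parts t i).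
Proof.
rewrite /is_intpart zero_notin_row_parts andbT.
by apply: sort_sorted => x y; apply: leq_total.
Qed.

Lemma sumn_row_parts_leq t i : sumn (row_parts t i) <= q * k.
Proof.
rewrite sumn_row_parts -[X in _ <= X * k](card_ord q) -sum_nat_const.
rewrite big_mkcond; apply: leq_sum => b _; case: ifP => // _.
by case: (t b) => [[c a]|] /=.
Qed.

Lemma freq_row_parts t i (a : 'I_k) :
  freq a.+1 (row_parts t i) = content t (Some (i, a)).
Proof.
rewrite /freq (seq.permP (permEl (perm_sort _ _))) count_map count_filter.
rewrite ffunE cardsE cardE size_filter -enumT; apply: eq_count => b.
rewrite [RHS]unfold_in /=; case: (t b) => [[c j]|] //=.
by rewrite andbC !(inj_eq Some_inj) xpair_eqE eqSS.
Qed.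

Lemma sum_size_row_parts t :
  content t None + \sum_(i < M) size (row_parts t i) = q.
Proof.
rewrite -[RHS]card_ord -(cardsT 'I_q) -(sum_content t predT) big_row_type.
congr (_ + _); apply: eq_bigr => i _.
rewrite (size_freq (zero_notin_row_parts t i) (row_parts_leq t i)).
by apply: eq_bigr => a _; rewrite freq_row_parts.
Qed.

Lemma sum_content_pattern t (c : 'I_M) :
  \sum_(i < M.+1 | i <= c) content (pattern t) i
    = sumn (row_parts t c) + k * \sum_(i < M | i < c) size (row_parts t i).
Proof.
rewrite (sum_content _ (fun i : 'I_M.+1 => i <= c)) sumn_row_parts.
rewrite (eq_bigr _ (fun i _ => size_row_parts t i)).
rewrite [in RHS]exchange_big big_distrr /= [X in X + _]big_mkcond -big_split /=.
under eq_bigr do rewrite -card_row_class_leq.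
rewrite -sum1dep_card.
transitivity (\sum_b \sum_(j < k | row_class (t b) j <= c) 1).
  by rewrite pair_big_dep; apply: eq_bigl => -[b j]; rewrite ffunE.
by apply: eq_bigr => b _; rewrite sum1dep_card.
Qed.

End RowPartitions.
End RowTypes.

(** * Admissible families of partitions *)

Section Admissible.
Variables (M k q : nat) (n : nat -> nat).
Hypotheses (k_gt0 : 0 < k) (sum_n : \sum_(i < M.+1) n i = q * k).
Local Notation partitions := {ffun 'I_M -> intpart_upto (\sum_(i < M.+1) n i)}.
Local Notation adm := (@admissible k M.+1 n).
Implicit Type lam : partitions.

Definition sizes_before lam (j : nat) : nat :=
  \sum_(i < M | i < j) size (lam i).

Lemma admissible_nat lam :
  adm lam =
    [forall j : 'I_M,
      [&& sumn (lam j) + k * sizes_before lam j == \sum_(i < M.+1 | i <= j) n i,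
          all (leq^~ k) (lam j) &
          k * size (lam j) <= n j.+1 + sumn (lam j)]].
Proof.
apply: eq_forallb => j; congr [&& _, _ & _].
- rewrite -GRing.subr_eq GRing.opprK.
  by rewrite -!(big_morph Posz PoszD (erefl _)) -PoszM -PoszD eqz_nat.
- by apply/bigmax_leqP_seq/allP => le_k a /le_k; [apply | move=> + _; apply].
rewrite Num.Theory.ler_pdivlMr ?Num.Theory.ltr0n // -GRing.natrM mulnC.
by rewrite Num.Theory.ler_nat.
Qed.

Lemma sizes_before_last lam : sizes_before lam M = \sum_(i < M) size (lam i).
Proof. by apply: eq_bigl => i; rewrite ltn_ord. Qed.

Lemma prefix_sum_last : \sum_(i < M.+1 | i <= M) n i = k * q.
Proof. by rewrite mulnC -sum_n; apply: eq_bigl => i; rewrite -ltnS ltn_ord. Qed.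

Lemma quotient_conditionE lam (j : 'I_M) :
    sumn (lam j) + k * sizes_before lam j = \sum_(i < M.+1 | i <= j) n i ->
  (k * size (lam j) <= n j.+1 + sumn (lam j))
    = (k * sizes_before lam j.+1 <= \sum_(i < M.+1 | i <= j.+1) n i).
Proof.
have -> : \sum_(i < M.+1 | i <= j.+1) n i
    = \sum_(i < M.+1 | i <= j) n i + n j.+1.
  exact: (big_ord_ltS _ _ (lift ord0 j)).
move=> <-; rewrite /sizes_before big_ord_ltS mulnDr addnAC.
by rewrite [X in _ = (X <= _)]addnC leq_add2r [n _ + _]addnC.
Qed.

(* The quotient condition on lam j follows from the sum condition on lam j.+1,
   and so matters only for the last index j. *)
Lemma admissibleP lam :
  reflect [/\ forall j : 'I_M, sumn (lam j) + k * sizes_before lam j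
                = \sum_(i < M.+1 | i <= j) n i,
              forall j, all (leq^~ k) (lam j) &
              \sum_(i < M) size (lam i) <= q]
    (adm lam).
Proof.
rewrite admissible_nat -sizes_before_last.
apply: (iffP forallP) => [adm | [sum_lam lam_le_k size_le_q] j].
  have sum_lam j : sumn (lam j) + k * sizes_before lam j
      = \sum_(i < M.+1 | i <= j) n i by have /and3P[/eqP] := adm j.
  split=> // [j|]; first by have /and3P[] := adm j.
  have [M0|M_gt0] := posnP M.
    rewrite sizes_before_last big1 // => i.
    by have := ltn_ord i; rewrite [X in _ < X]M0.
  have lastM : M.-1 < M by rewrite prednK.
  have /and3P[_ _] := adm (Ordinal lastM).
  by rewrite quotient_conditionE //= prednK // prefix_sum_last leq_pmul2l.
apply/and3P; split; rewrite ?sum_lam //.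
rewrite quotient_conditionE //; have [jM|Mj] := ltnP j.+1 M.
  by rewrite -(sum_lam (Ordinal jM)) leq_addl.
have -> : j.+1 = M by apply/eqP; rewrite eqn_leq ltn_ord.
by rewrite prefix_sum_last leq_mul2l size_le_q orbT.
Qed.

End Admissible.

Section CountingPatterns.
Variables (M k' q : nat) (n : nat -> nat).
Local Notation k := k'.+1.
Hypothesis sum_n : \sum_(i < M.+1) n i = q * k.
Local Notation partitions := {ffun 'I_M -> intpart_upto (\sum_(i < M.+1) n i)}.
Local Notation adm := (@admissible k M.+1 n).
Local Notation row_types := {ffun 'I_q -> row_type M k'}.
Implicit Types (lam : partitions) (t : row_types).

Definition class_sizes : {ffun 'I_M.+1 -> nat} := [ffun i : 'I_M.+1 => n i].

Lemma row_parts_intpart t i :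
  is_intpart (row_parts t i) && (sumn (row_parts t i) <= \sum_(i < M.+1) n i).
Proof. by rewrite is_intpart_row_parts sum_n sumn_row_parts_leq. Qed.

Definition row_partitions t : partitions :=
  [ffun i => MkIntpart (row_parts_intpart t i)].

Lemma sum_size_row_partitions t :
  \sum_(i < M) size (row_partitions t i) = \sum_(i < M) size (row_parts t i).
Proof. by apply: eq_bigr => i _; rewrite ffunE. Qed.

Lemma sum_class_sizes (j : nat) :
  \sum_(i < M.+1 | i < j) class_sizes i = \sum_(i < M.+1 | i < j) n i.
Proof. by apply: eq_bigr => i _; rewrite ffunE. Qed.

Lemma admissible_row_partitions t :
  adm (row_partitions t) = (content (pattern t) == class_sizes).
Proof.
have sumE (j : 'I_M) :
    sumn (row_partitions t j) + k * sizes_before (row_partitions t) j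
      = \sum_(i < M.+1 | i <= j) content (pattern t) i.
  rewrite sum_content_pattern ffunE; congr (_ + k * _).
  by apply: eq_bigr => i _; rewrite ffunE.
apply/(admissibleP _ sum_n)/eqP => [//|[sum_lam _ _]|eq_content].
  apply: eq_from_prefix_sums => -[|j]; first by rewrite !big_pred0.
  rewrite ltnS leq_eqVlt => /predU1P[->|jM]; last first.
    by rewrite sum_class_sizes -(sumE (Ordinal jM)) (sum_lam (Ordinal jM)).
  rewrite sum_class_sizes (prefix_sum_last sum_n).
  rewrite (sum_content _ (fun i : 'I__ => i < M.+1)).
  rewrite (_ : [set _ | _] = setT) ?cardsT ?card_prod ?card_ord 1?mulnC //.
  by apply/setP => x; rewrite !inE ltn_ord.
split=> [j|j|].
- by rewrite sumE eq_content; apply: (sum_class_sizes j.+1).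
- by rewrite ffunE row_parts_leq.
by rewrite sum_size_row_partitions -[leqRHS](sum_size_row_parts t) leq_addl.
Qed.

Definition row_content lam : {ffun row_type M k' -> nat} :=
  [ffun y : row_type M k' =>
     if y is Some (i, a) then freq a.+1 (lam i)
     else q - \sum_(i < M) size (lam i)].

Lemma row_partitions_eq t lam : adm lam ->
  (row_partitions t == lam) = (content t == row_content lam).
Proof.
case/(admissibleP _ sum_n) => // _ lam_le_k _; apply/eqP/eqP => [<-|eq_content].
  apply/ffunP => -[[i a]|]; rewrite [RHS]ffunE.
    by rewrite -freq_row_parts ffunE.
  by rewrite -[in RHS](sum_size_row_parts t) sum_size_row_partitions addnK.
apply/ffunP => i; apply/val_inj; rewrite ffunE /=.
apply: (@eq_bounded_intpart k) => [||||a].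
- exact: is_intpart_row_parts.
- exact: is_intpart_parts.
- exact: row_parts_leq.
- exact: lam_le_k.
by rewrite freq_row_parts eq_content ffunE.
Qed.

Lemma sum_row_content lam : adm lam -> \sum_y row_content lam y = q.
Proof.
case/(admissibleP _ sum_n) => // _ lam_le_k size_le_q.
rewrite big_row_type ffunE -[RHS](subnK size_le_q); congr (_ + _).
apply: eq_bigr => i _.
rewrite (size_freq (zero_notin_parts (lam i)) (lam_le_k i)).
by apply: eq_bigr => a _; rewrite ffunE.
Qed.

Lemma card_patterns :
  #|[set t : row_types | content (pattern t) == class_sizes]|
    = \sum_(lam | adm lam)
        #|[set t : row_types | content t == row_content lam]|.
Proof.
rewrite -sum1dep_card (partition_big row_partitions adm) => [|t].
  apply: eq_bigr => lam adm_lam; rewrite -sum1dep_card; apply: eq_bigl => t.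
  rewrite -row_partitions_eq // -admissible_row_partitions.
  by rewrite andb_idl // => /eqP->.
by rewrite admissible_row_partitions.
Qed.

Lemma prod_row_content lam : adm lam ->
  \prod_y (row_content lam y)`!
    = (q - \sum_(i < M) size (lam i))`! *
      \prod_(i < M) \prod_(a <- undup (lam i)) (freq a (lam i))`!.
Proof.
case/(admissibleP _ sum_n) => // _ lam_le_k _.
rewrite big_row_type ffunE; congr (_ * _); apply: eq_bigr => i _.
rewrite (big_freq (zero_notin_parts _) (lam_le_k i) _ (F := factorial)) //.
by apply: eq_bigr => a _; rewrite ffunE.
Qed.

End CountingPatterns.

Lemma perm_allpairs_Tagged (I : finType) (J : I -> finType) :
  perm_eq [seq Tagged J j | i <- enum I, j <- enum (J i)]
    (enum {: {i : I & J i}}).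
Proof.
apply: uniq_perm; rewrite ?enum_uniq //.
  apply: allpairs_uniq_dep => [|i _|]; rewrite ?enum_uniq //.
  by move=> [i j] [i' j'] _ _.
move=> [i j]; rewrite mem_enum inE; apply/allpairsPdep.
by exists i, j; rewrite !mem_enum.
Qed.

Lemma decomposition_Tagged (X I : finType) (J : I -> finType)
    (sigma : SIM X) (s : forall i, J i -> seq X) :
    decomposition sigma [seq Path (s i j) | i <- enum I, j <- enum (J i)] ->
  decomposition sigma
    [seq Path (s (tag p) (tagged p)) | p <- enum {: {i : I & J i}}].
Proof.
apply: decomposition_perm; rewrite perm_sym.
pose path_of (p : {i : I & J i}) := Path (s (tag p) (tagged p)).
have := perm_map path_of (perm_allpairs_Tagged J).
by rewrite map_allpairs perm_sym.
Qed.

Lemma interleavable_single_step (X P : finType) (S : P -> seq X) (M k' q : nat)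
    (class : P -> 'I_M.+1) (w : {ffun 'I_q * 'I_k'.+1 -> P}) :
    (forall p p', size (S p) + class p = size (S p') + class p') ->
  interleavable S w = single_step_rows [ffun x => class (w x)].
Proof.
move=> size_class; apply: eq_forallb => b; apply: eq_forallb => i.
apply: eq_forallb => j; rewrite !ffunE; congr (_ ==> (_ && _)).
  rewrite -(leq_add2r (class (w (b, j)))) (size_class _ (w (b, i))).
  by rewrite leq_add2l.
rewrite -(leq_add2r (class (w (b, i)))) (size_class (w (b, i)) (w (b, j))).
by rewrite addSnnS leq_add2l.
Qed.

Section RootCount.
Variables (X : finType) (sigma : SIM X) (M k' q : nat) (n : nat -> nat).
Local Notation k := k'.+1.
Local Notation P := {i : 'I_M.+1 & 'I_(n i)}.
Variable S : P -> seq X.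
Hypothesis sum_n : \sum_(i < M.+1) n i = q * k.
Hypothesis sigma_dec : decomposition sigma [seq Path (S p) | p <- enum {: P}].
Hypothesis path_nontrivial : forall p, 1 < size (S p).
Hypothesis size_class :
  forall p p', size (S p) + tag p = size (S p') + tag p'.

Lemma root_count_patterns :
  root_count k sigma * q`! =
    #|[set t : {ffun 'I_q -> row_type M k'} |
        content (pattern t) == class_sizes M n]| * \prod_(i < M.+1) (n i)`!.
Proof.
have cardP : #|{: P}| = q * k by rewrite card_Tagged_ord.
rewrite (root_count_interleavable sigma_dec cardP path_nontrivial).
under eq_finset do rewrite (interleavable_single_step _ size_class).
rewrite card_injections_coloring; last first.
  by rewrite cardP card_prod !card_ord.
rewrite card_single_step_rows content_tag; congr (_ * _).
by apply: eq_bigr => i _; rewrite ffunE.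
Qed.

End RootCount.

Import GRing.Theory Num.Theory.
Local Open Scope ring_scope.

Lemma root_term_row_content (M k' q : nat) (n : nat -> nat)
    (lam : {ffun 'I_M -> intpart_upto (\sum_(i < M.+1) n i)}) :
    (\sum_(i < M.+1) n i = q * k'.+1)%N -> @admissible k'.+1 M.+1 n lam ->
  @root_term k'.+1 M.+1 n lam * q`!%:R =
    (#|[set t : {ffun 'I_q -> row_type M k'} |
         content t == row_content k' q lam]| * \prod_(i < M.+1) (n i)`!)%N%:R.
Proof.
move=> sum_n adm_lam; rewrite /root_term {1}sum_n mulnK //.
rewrite -(prod_row_content sum_n adm_lam).
have := card_content (A := 'I_q) (mu := row_content k' q lam).
rewrite (sum_row_content sum_n adm_lam) card_ord => <- //.
rewrite natrM [(_ * \prod_(i < M.+1) _)%N%:R]natrM mulrCA -mulrA.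
rewrite mulVf ?mulr1 //.
by rewrite pnatr_eq0 -lt0n prodn_gt0 // => y; apply: fact_gt0.
Qed.

Theorem theorem3 (X : finType) (sigma : SIM X) (k m : nat) (n : nat -> nat)
    (s : forall i : 'I_m, 'I_(n i) -> seq X) (L : int)
    (hk : (0 < k)%N) (hm : (2 <= m)%N)
    (hn : forall i : 'I_m, (0 < n i)%N)
    (hkn : (k %| \sum_(i < m) n i)%N)
    (hdec : decomposition sigma
              [seq Path (s i j) | i <- enum 'I_m, j <- enum 'I_(n i)])
    (hL : forall (i : 'I_m) (j : 'I_(n i)), (size (s i j))%:Z = L - i%:Z)
    (hsize : forall (i : 'I_m) (j : 'I_(n i)), (2 <= size (s i j))%N) :
  (root_count k sigma)%:R
  = \sum_(lam : {ffun 'I_m.-1 -> intpart_upto (\sum_(i < m) n i)}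
          | admissible k lam) root_term k lam :> rat.
Proof.
case: m => [|M] // in s hm hn hkn hdec hL hsize *.
case: k => [|k'] // in hk hkn *.
pose S (p : {i : 'I_M.+1 & 'I_(n i)}) := s (tag p) (tagged p).
have sum_n := esym (divnK hkn).
have size_class p p' : (size (S p) + tag p = size (S p') + tag p')%N.
  by apply/eqP; rewrite -eqz_nat !PoszD !hL !subrK.
have := root_count_patterns sum_n (decomposition_Tagged hdec)
  (fun p => hsize _ _) size_class.
set q := (_ %/ _)%N in sum_n * => countE.
have q_fact : q`!%:R != 0 :> rat by rewrite pnatr_eq0 -lt0n fact_gt0.
apply: (mulIf q_fact); rewrite -natrM countE card_patterns // big_distrl.
rewrite natr_sum mulr_suml; apply: eq_bigr => lam adm_lam.
by rewrite root_term_row_content.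
Qed.
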